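(* Suppose that $G$ satisfies: (i) there is $0<\alpha<1$ such that for $m$-almost every $\underline{x}\in\Sigma_A^+$ one has $d(G(\underline{x},y_1),G(\underline{x},y_2))\le \alpha\, d(y_1,y_2)$ for all $y_1,y_2\in K$; (ii) for every $y\in K$ there is $k_y\ge0$ with $d(G(\underline{x}^1,y),G(\underline{x}^2,y))\le k_y\,d_\theta(\underline{x}^1,\underline{x}^2)$ for all $\underline{x}^1,\underline{x}^2\in\Sigma_A^+$, and $\sup_{y\in K}k_y<\infty$. Let $\mu_0$ be the unique $F$-invariant probability measure in $S^\infty$, and let $\xi\in(0,1)$ and $M>0$ be the constants of the spectral gap decomposition of $F^*$ on $S^\infty$ (see context). Then for all Lipschitz functions $h,f:\Sigma_A^+\times K\to\mathbb{R}$ (with respect to the metric $d_\theta+d$) and all $n\ge1$, $$\left|\int (h\circ F^n)\,f\,d\mu_0-\int h\,d\mu_0\int f\,d\mu_0\right|\le M\,\xi^n\,\|f\mu_0\|_{S^\infty}\,\|h\|_{Lip}.$$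
   Context: Base. Let $A$ be an aperiodic $N_0\times N_0$ matrix with entries in $\{0,1\}$ (some power of $A$ has all entries positive), $\Sigma_A^+=\{\underline{x}=(x_i)_{i\ge 0}: x_i\in\{1,\dots,N_0\},\ A_{x_ix_{i+1}}=1\ \forall i\}$, with the metric $d_\theta(\underline{x},\underline{y})=\sum_{i\ge0}\theta^i(1-\delta(x_i,y_i))$, where $\theta\in(0,1)$ is fixed and $\delta(a,b)=1$ if $a=b$, $0$ otherwise. Let $\sigma$ be the left shift on $\Sigma_A^+$ and $m$ a Markov measure associated to $(\Sigma_A^+,\sigma)$ (the $\sigma$-invariant probability given by a stochastic matrix $(p_{ij})$ with $p_{ij}>0$ iff $A_{ij}=1$ and its stationary probability vector). For $\varphi:\Sigma_A^+\to\mathbb{R}$ let $|\varphi|_\theta$ be its Lipschitz constant with respect to $d_\theta$, $\mathcal{F}_\theta(\Sigma_A^+)=\{\varphi:|\varphi|_\theta<\infty\}$, $\|\varphi\|_\theta=\|\varphi\|_\infty+|\varphi|_\theta$. Skew product. $(K,d)$ is a compact metric space with $\operatorname{diam}(K)=1$; $\Sigma:=\Sigma_A^+\times K$; $G:\Sigma\to K$ is measurable (Borel) and $F:\Sigma\to\Sigma$ is $F(\underline{x},y)=(\sigma(\underline{x}),G(\underline{x},y))$. Put $\gamma_{\underline{x}}=\{\underline{x}\}\times K$, $\pi_1(\underline{x},y)=\underline{x}$, $\pi_2(\underline{x},y)=y$, and let $\pi_1^*$, $\pi_2^*$ denote push-forward of measures. The transfer operator is $F^*\mu(E)=\mu(F^{-1}(E))$.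 For a Lipschitz function $h$ on $(\Sigma,d_\theta+d)$, $\|h\|_{Lip}$ is the sum of its sup norm and its Lipschitz constant. Spaces of measures. For a finite signed Borel measure $\nu$ on a compact metric space $X$, $\|\nu\|_W=\sup\{|\int g\,d\nu| : g:X\to\mathbb{R}\text{ Lipschitz with constant}\le1,\ \|g\|_\infty\le1\}$. Let $\mathcal{AB}$ be the set of finite signed Borel measures $\mu$ on $\Sigma$, with Jordan decomposition $\mu=\mu^+-\mu^-$, such that $\pi_1^*\mu^+\ll m$ and $\pi_1^*\mu^-\ll m$; write $\phi_1=\frac{d(\pi_1^*\mu)}{dm}$. For positive $\mu\in\mathcal{AB}$ let $\{\mu_{\gamma_{\underline{x}}}\}$ be its Rokhlin disintegration along the leaves: probabilities on $\Sigma$ with $\mu_{\gamma_{\underline{x}}}(\gamma_{\underline{x}})=1$ for $\phi_1m$-a.e. $\underline{x}$, $\underline{x}\mapsto\mu_{\gamma_{\underline{x}}}(E)$ measurable, and $\mu(E)=\int\mu_{\gamma_{\underline{x}}}(E)\phi_1(\underline{x})\,dm(\underline{x})$ for all measurable $E\subset\Sigma$. The restriction of positive $\mu$ to $\gamma_{\underline{x}}$ is the positive measure on $K$ given by $\mu|_{\gamma_{\underline{x}}}(B)=\phi_1(\underline{x})\,\mu_{\gamma_{\underline{x}}}(\pi_2^{-1}(B))$ (zero where $\phi_1(\underline{x})=0$); for signed $\mu\in\mathcal{AB}$, $\mu|_{\gamma_{\underline{x}}}:=\mu^+|_{\gamma_{\underline{x}}}-\mu^-|_{\gamma_{\underline{x}}}$.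 Set $\|\mu\|_\infty=\operatorname{ess\,sup}_{\underline{x}}\|\mu|_{\gamma_{\underline{x}}}\|_W$ (with respect to $m$), $\mathcal{L}^\infty=\{\mu\in\mathcal{AB}:\|\mu\|_\infty<\infty\}$, $S^\infty=\{\mu\in\mathcal{L}^\infty:\phi_1\in\mathcal{F}_\theta(\Sigma_A^+)\}$ and $\|\mu\|_{S^\infty}=\|\phi_1\|_\theta+\|\mu\|_\infty$. Facts and notation used in the statement. Under (i) there is a unique $F$-invariant probability measure $\mu_0\in S^\infty$, and $F^*:S^\infty\to S^\infty$ can be written $F^*=P+N$ with $P,N$ linear, $P^2=P$, $\dim\operatorname{Im}P=1$, $PN=NP=0$, and with constants $0<\xi<1$, $M>0$ such that $\|N^n\mu\|_{S^\infty}\le M\xi^n\|\mu\|_{S^\infty}$ for all $\mu\in S^\infty$, $n\ge1$; these are the $\xi$ and $M$ in the claim. The signed measure $f\mu_0$ is $f\mu_0(E)=\int_E f\,d\mu_0$; under (i) and (ii), $f\mu_0\in S^\infty$ for every Lipschitz $f$, so the right-hand side makes sense. *)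

(* Defs.v *)
From HB Require Import structures.
From mathcomp Require Import all_boot all_order all_algebra.
From mathcomp Require Import all_classical all_reals all_analysis.
From mathcomp Require Import measurable_realfun ess_sup_inf.

Set Implicit Arguments.
Unset Strict Implicit.
Unset Printing Implicit Defensive.

Import Order.TTheory GRing.Theory Num.Theory.
Import numFieldNormedType.Exports.

Local Open Scope classical_set_scope.
Local Open Scope ring_scope.

(* Measurable types are pointed in MathComp-Analysis, hence the base point. *)
#[short(type="pmetricType")]
HB.structure Definition PointedMetric (R : numDomainType) :=
  {X of Metric R X & Pointed X}.

Notation borel X := (g_sigma_algebraType (@open X)).

Section lipschitz.
Context {R : realType} {T : Type}.
Variable dist : T -> T -> R.
Local Open Scope ereal_scope.

(* The least Lipschitz constant; +oo when there is none. *)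
Definition lip_const (f : T -> R) : \bar R :=
  ereal_inf [set L%:E | L in
    [set L : R | (0 <= L /\ forall x y, `|f x - f y| <= L * dist x y)%R]].

Definition sup_norm (f : T -> R) : \bar R :=
  ereal_sup [set `|f x|%:E | x in [set: T]].

Definition lip_norm (f : T -> R) : \bar R := sup_norm f + lip_const f.

Definition is_lipschitz (f : T -> R) : Prop := lip_const f < +oo.

End lipschitz.

Section signed_measures.
Context {R : realType} {d : measure_display} {T : measurableType d}.
Implicit Types (nu : {charge set T -> \bar R}) (g : T -> R).

(* Charges are functions on all sets; as measures only their values on
   measurable sets matter. *)
Definition charge_eq nu1 nu2 : Prop :=
  forall E, measurable E -> nu1 E = nu2 E.

Definition hahn nu :
    {PN : set T * set T | hahn_decomposition nu PN.1 PN.2}.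
Proof.
apply: cid; have [P [N PN]] := Hahn_decomposition nu.
by exists (P, N).
Defined.

Definition charge_pos nu : {finite_measure set T -> \bar R} :=
  jordan_pos (svalP (hahn nu)).

Definition charge_neg nu : {finite_measure set T -> \bar R} :=
  jordan_neg (svalP (hahn nu)).

Definition charge_integral nu g : R :=
  \int[charge_pos nu]_x g x - \int[charge_neg nu]_x g x.

(* E |-> \int[mu]_(x in E) f x; the second branch is a dummy value for
   non-integrable f. *)
Definition density_charge (mu : {measure set T -> \bar R}) (f : T -> R) :
    {charge set T -> \bar R} :=
  match pselect (mu.-integrable [set: T] (EFin \o f)) with
  | left intf => induced_charge intf
  | right _ => czero
  end.

End signed_measures.

Definition push_charge {R : realType} {d1 d2 : measure_display}
    {T1 : measurableType d1} {T2 : measurableType d2} (f : T1 -> T2)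
    (mf : measurable_fun [set: T1] f) (nu : {charge set T1 -> \bar R}) :
    {charge set T2 -> \bar R} :=
  measure_function_pushforward__canonical__charge_Charge nu mf.

Section metric_spaces.
Context {R : realType} {X : pmetricType R}.
Local Open Scope ereal_scope.

Definition diam : \bar R :=
  ereal_sup [set (mdist x y)%:E | x in [set: X] & y in [set: X]].

Definition wnorm (nu : {charge set (borel X) -> \bar R}) : \bar R :=
  ereal_sup [set `|charge_integral nu g|%:E | g in
    [set g : X -> R | (forall x y, `|g x - g y| <= mdist x y)%R /\
                      (forall x, `|g x| <= 1)%R]].

End metric_spaces.
Arguments diam {R} X.

(* Measures on the product live on the product of the Borel sigma-algebras,
   which is the Borel sigma-algebra of the product when the factors are
   separable, in particular when they are compact. *)
Section spaces_of_measures.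
Context {R : realType} {X K : pmetricType R}.
Local Notation XK := (borel X * borel K)%type.
Variable m : probability (borel X) R.
Implicit Types mu : {charge set XK -> \bar R}.
Local Open Scope ereal_scope.
Local Open Scope charge_scope.

Definition marginal mu : {charge set (borel X) -> \bar R} :=
  push_charge measurable_fst mu.

Definition in_AB mu : Prop :=
  marginal (charge_of_finite_measure (charge_pos mu)) `<< m /\
  marginal (charge_of_finite_measure (charge_neg mu)) `<< m.

Definition marginal_density mu : borel X -> \bar R := 'd (marginal mu) '/d m.

Definition leaf (x : X) : set XK := [set p | p.1 = x].

Definition is_disintegration (mu : {finite_measure set XK -> \bar R})
    (kappa : borel X -> probability XK R) : Prop :=
  [/\ {ae (pushforward mu fst), forall x, kappa x (leaf x) = 1},
      forall E, measurable E -> 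
        measurable_fun [set: borel X] (fun x => kappa x E) &
      forall E, measurable E ->
        mu E = \int[m]_x (kappa x E *
                          marginal_density (charge_of_finite_measure mu) x)].

Definition leaf_restriction (mu : {finite_measure set XK -> \bar R})
    (kappa : borel X -> probability XK R) (x : borel X) :
    {charge set (borel K) -> \bar R} :=
  cscale (fine (marginal_density (charge_of_finite_measure mu) x))
    (push_charge measurable_snd (charge_of_finite_measure (kappa x))).

Definition signed_leaf_restriction mu
    (kappap kappan : borel X -> probability XK R) (x : borel X) :
    {charge set (borel K) -> \bar R} :=
  cadd (leaf_restriction (charge_pos mu) kappap x)
       (copp (leaf_restriction (charge_neg mu) kappan x)).

(* Disintegrations are unique up to null sets, so all of them give the same
   essential supremum; the infimum selects this common value without choosing
   a disintegration. *)
Definition norm_infty mu : \bar R :=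
  ereal_inf [set s | exists kappap kappan : borel X -> probability XK R,
    [/\ is_disintegration (charge_pos mu) kappap,
        is_disintegration (charge_neg mu) kappan &
        s = ess_sup m
              (fun x => wnorm (signed_leaf_restriction mu kappap kappan x))]].

Definition in_Linfty mu : Prop := in_AB mu /\ norm_infty mu < +oo.

Definition density_version mu (phi : X -> R) : Prop :=
  {ae m, forall x, marginal_density mu x = (phi x)%:E}.

(* As a density, phi_1 is only defined up to m-null sets: phi_1 in F_theta
   means that some version is Lipschitz. This version is unique when m has
   full support, which Markov measures have, and the infimum is then its norm
   (the other versions have norm +oo). *)
Definition density_norm mu : \bar R :=
  ereal_inf [set lip_norm mdist phi | phi in density_version mu].

Definition in_Sinfty mu : Prop :=
  in_Linfty mu /\
  exists2 phi, density_version mu phi & is_lipschitz mdist phi.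

Definition norm_Sinfty mu : \bar R := density_norm mu + norm_infty mu.

(* Linearity, on the subspace S, of an operator on measures; the formulation
   includes compatibility with charge_eq. *)
Definition linear_on (S : set (charge XK R))
    (L : {charge set XK -> \bar R} -> {charge set XK -> \bar R}) : Prop :=
  forall (a : R) mu nu rho, S mu -> S nu -> S rho ->
    charge_eq rho (cadd (cscale a mu) nu) ->
    charge_eq (L rho) (cadd (cscale a (L mu)) (L nu)).

Definition transfer (F : XK -> XK) mu : set XK -> \bar R := pushforward mu F.

Record spectral_gap (F : XK -> XK)
    (P N : {charge set XK -> \bar R} -> {charge set XK -> \bar R})
    (xi M : R) : Prop := {
  gap_P_stable : forall mu, in_Sinfty mu -> in_Sinfty (P mu) ;
  gap_N_stable : forall mu, in_Sinfty mu -> in_Sinfty (N mu) ;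
  gap_P_linear : linear_on in_Sinfty P ;
  gap_N_linear : linear_on in_Sinfty N ;
  gap_decomposition : forall mu, in_Sinfty mu ->
    forall E, measurable E -> transfer F mu E = cadd (P mu) (N mu) E ;
  gap_PP : forall mu, in_Sinfty mu -> charge_eq (P (P mu)) (P mu) ;
  gap_PN : forall mu, in_Sinfty mu -> charge_eq (P (N mu)) czero ;
  gap_NP : forall mu, in_Sinfty mu -> charge_eq (N (P mu)) czero ;
  gap_dim_imP : exists2 nu, in_Sinfty nu & ~ charge_eq (P nu) czero /\
    forall mu, in_Sinfty mu ->
      exists c : R, charge_eq (P mu) (cscale c (P nu)) ;
  gap_xi_gt0 : (0 < xi)%R ;
  gap_xi_lt1 : (xi < 1)%R ;
  gap_M_gt0 : (0 < M)%R ;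
  gap_bound : forall mu (n : nat), in_Sinfty mu -> (1 <= n)%N ->
    norm_Sinfty (iter n N mu) <= (M * xi ^+ n)%:E * norm_Sinfty mu
}.

End spaces_of_measures.

Record aperiodic_matrix (N0 : nat) := AperiodicMatrix {
  aper_mx :> 'M[nat]_N0 ;
  aper_size : (0 < N0)%N ;
  aper_01 : forall i j, aper_mx i j = 0%N \/ aper_mx i j = 1%N ;
  aper_pow : exists2 k, (0 < k)%N & forall i j, (0 < (aper_mx ^+ k) i j)%N
}.

(* theta is a parameter of the type so that d_theta can be its metric. *)
Record shift_space {R : realType} {N0 : nat} (A : aperiodic_matrix N0)
    (theta : {itv R & `]0%Z, 1%Z[}) := ShiftSpace {
  seq_of :> nat -> 'I_N0 ;
  seq_admissible : forall i, A (seq_of i) (seq_of i.+1) = 1%N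
}.

Section shift_space.
Context {R : realType} {N0 : nat}.
Variables (A : aperiodic_matrix N0) (theta : {itv R & `]0%Z, 1%Z[}).

Local Notation X := (shift_space A theta).

Definition d_theta (x y : X) : R :=
  limn (series (fun i => theta%:num ^+ i * (x i != y i)%:R)).

Definition shift (x : X) : X :=
  ShiftSpace theta (fun i => seq_admissible x i.+1).

Lemma shift_space_eq (x y : X) : (forall i, x i = y i) -> x = y.
Proof.
case: x y => [x hx] [y hy] /= /funext xy.
by subst y; congr ShiftSpace; exact: Prop_irrelevance.
Qed.

Lemma d_theta_cvg (x y : X) :
  cvgn (series (fun i => theta%:num ^+ i * (x i != y i)%:R : R)).
Proof.
have t0 : 0 <= theta%:num :> R by [].
have t1 : theta%:num < 1 :> R by [].
apply: (@series_le_cvg _ _ (geometric 1 theta%:num)).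
- by move=> n; rewrite mulr_ge0// exprn_ge0.
- by move=> n; rewrite /geometric/= mul1r exprn_ge0.
- move=> n; rewrite /geometric/= mul1r ler_piMr ?exprn_ge0//.
  by case: (x n != y n).
- by apply: is_cvg_geometric_series; rewrite ger0_norm.
Qed.

Lemma d_theta_xx x : d_theta x x = 0.
Proof.
rewrite /d_theta (_ : series _ = cst 0) ?lim_cst//.
apply/funext => n; rewrite /series/= big1// => i _.
by rewrite eqxx mulr0.
Qed.

Lemma d_theta_sym x y : d_theta x y = d_theta y x.
Proof.
by rewrite /d_theta; congr (limn (series _)); apply/funext => i; rewrite eq_sym.
Qed.

Lemma d_theta_triangle y x z : d_theta x z <= d_theta x y + d_theta y z.
Proof.
rewrite /d_theta -lim_seriesD; [|exact: d_theta_cvg|exact: d_theta_cvg].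
apply: lim_series_le; [exact: d_theta_cvg| |].
  by apply: is_cvg_seriesD; exact: d_theta_cvg.
move=> i; rewrite -mulrDr ler_wpM2l ?exprn_ge0//.
rewrite /= -[leRHS]natrD ler_nat; case: (eqVneq (x i) (z i)) => //= xz.
by case: (eqVneq (x i) (y i)) => //= <-; rewrite xz.
Qed.

Lemma d_theta_positivity x y : d_theta x y = 0 -> x = y.
Proof.
move=> dxy; apply: shift_space_eq => i; apply/eqP/negPn/negP => xyi.
suff : 0 < d_theta x y by rewrite dxy ltxx.
have ti : 0 < theta%:num ^+ i :> R by rewrite exprn_gt0.
apply: (lt_le_trans ti); rewrite /d_theta.
have ndS : nondecreasing_seq
    (series (fun i => theta%:num ^+ i * (x i != y i)%:R : R)).
  apply/nondecreasing_seqP => n; rewrite /series/= big_nat_recr//=.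
  by rewrite lerDl mulr_ge0// exprn_ge0.
apply: le_trans (nondecreasing_cvgn_le ndS (@d_theta_cvg x y) i.+1).
by rewrite /series/= big_nat_recr//= xyi mulr1 lerDr sumr_ge0.
Qed.

Lemma aper_row (i : 'I_N0) : exists j, A i j == 1%N.
Proof.
have [[//|k] _ /(_ i i)] := aper_pow A.
rewrite exprS mxE => h; apply/existsP; apply: contraLR h => /existsPn A0.
rewrite -eqn0Ngt big1// => j _.
have [-> |Aij] := aper_01 A i j; first by rewrite mul0r.
by have := A0 j; rewrite Aij eqxx.
Qed.

Definition shift_space_point : X.
Proof.
have nx := fun i => svalP (cid (aper_row i)).
exists (fun k => iter k (fun i => sval (cid (aper_row i))) (Ordinal (aper_size A))).
by move=> k; rewrite iterS; exact/eqP/nx.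
Defined.

HB.instance Definition _ := gen_eqMixin X.
HB.instance Definition _ := gen_choiceMixin X.
HB.instance Definition _ := isMetric.Build R X
  d_theta_xx d_theta_positivity d_theta_sym d_theta_triangle.
HB.instance Definition _ := isPointed.Build X shift_space_point.

(* The cylinder values determine m; its shift-invariance follows from
   q *m p = q. *)
Definition is_markov_measure (m : probability (borel X) R) : Prop :=
  exists (p : 'M[R]_N0) (q : 'rV[R]_N0),
  [/\ (forall i j, 0 <= p i j) /\ (forall i, \sum_j p i j = 1),
      forall i j, (0 < p i j) = (A i j == 1%N),
      (forall i, 0 <= q 0 i) /\ \sum_i q 0 i = 1,
      q *m p = q &
      forall (w : nat -> 'I_N0) (k : nat),
        m [set x : X | forall i, (i <= k)%N -> x i = w i] =
        (q 0 (w 0%N) * \prod_(i < k) p (w i) (w i.+1))%:E].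

End shift_space.

Section skew_product.
Context {R : realType} {N0 : nat} {A : aperiodic_matrix N0}
  {theta : {itv R & `]0%Z, 1%Z[}} {K : pmetricType R}.
Local Notation X := (shift_space A theta).

Definition skew_product (G : borel X * borel K -> borel K)
    (p : borel X * borel K) : borel X * borel K := (shift p.1, G p).

Definition sum_dist (p q : borel X * borel K) : R :=
  mdist (p.1 : X) (q.1 : X) + mdist (p.2 : K) (q.2 : K).

End skew_product.

(* Main.v *)
Require Import Defs.
From HB Require Import structures.
From mathcomp Require Import all_boot all_order all_algebra.
From mathcomp Require Import all_classical all_reals all_analysis.
From mathcomp Require Import measurable_realfun ess_sup_inf.

Set Implicit Arguments.
Unset Strict Implicit.
Unset Printing Implicit Defensive.

Import Order.TTheory GRing.Theory Num.Theory.
Import numFieldNormedType.Exports.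

Local Open Scope classical_set_scope.
Local Open Scope ring_scope.

(** For the signed measure [f mu0] and [n >= 1], the relations between [P] and
    [N] give [F^n_* (f mu0) = P (f mu0) + N^n (f mu0)], so the integral of
    [(h \o F^n) f] against [mu0] is the sum of the integrals of [h] against
    these two measures ([charge_integral_density], [charge_integral_iter]).

    The first one is the product of the two means.  The image of [P] is a line,
    so [P (f mu0)] is a multiple of [P mu0].  The parts [N^n nu] fade away on
    Lipschitz test functions, hence [P] keeps the total mass of every measure,
    and [P mu0] integrates [h] as the invariant measure [mu0] does; comparing
    masses gives the factor ([charge_integral_P], [charge_integral_P_rank1]).

    The second one is at most [||h||_Lip ||N^n (f mu0)||_oo], and the spectral
    gap bounds the norm.  This inequality ([normr_charge_integral_le]) comes
    from integrating first along the leaves: on almost every leaf, [h] divided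
    by its Lipschitz norm is a test function of [||.||_W], and [m] has mass 1.
    Disintegrations become iterated integrals by composition of kernels and a
    change of density ([Rintegral_mixture], [Rintegral_disintegration]).

    The gap is a statement about the strong space, to which [f mu0] must
    belong.  Its variation has an absolutely continuous marginal
    ([in_AB_density]), so membership only depends on the norm being finite
    ([in_Sinfty_norm_lty]); and if the norm is infinite, so is the right-hand
    side, unless [h] vanishes. *)

(** * Integration against signed measures *)

Definition bounded_measurable {R : realType} {d} {T : measurableType d}
    (g : T -> R) : Prop :=
  measurable_fun [set: T] g /\ exists C : R, forall x, `|g x| <= C.

Section charge_integral_theory.
Context {R : realType} {d : measure_display} {T : measurableType d}.
Implicit Types (nu : {charge set T -> \bar R}) (g : T -> R).

Lemma bounded_measurable_cst (r : R) : bounded_measurable (fun _ : T => r).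
Proof. by split; [exact: measurable_cst|exists `|r|]. Qed.

Lemma bounded_measurableM f g : bounded_measurable f -> bounded_measurable g ->
  bounded_measurable (fun x => f x * g x).
Proof.
move=> [mf [C fC]] [mg [D gD]]; split; first exact: measurable_funM.
by exists (C * D) => x; rewrite normrM ler_pM.
Qed.

Lemma bounded_measurable_integrable (mu : {measure set T -> \bar R}) g :
  (mu [set: T] < +oo)%E -> bounded_measurable g ->
  mu.-integrable [set: T] (EFin \o g).
Proof.
move=> muT [mg [C gC]]; apply: measurable_bounded_integrable => //.
exists C; split; first exact: num_real.
by move=> y Cy x _; exact: le_trans (gC x) (ltW Cy).
Qed.

Lemma finite_measureT (mu : {finite_measure set T -> \bar R}) :
  (mu [set: T] < +oo)%E.
Proof. by rewrite ltey_eq fin_num_measure. Qed.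

Lemma Rintegral_measure_eqD (a b c e : {measure set T -> \bar R}) g :
  a.-integrable [set: T] (EFin \o g) -> b.-integrable [set: T] (EFin \o g) ->
  c.-integrable [set: T] (EFin \o g) -> e.-integrable [set: T] (EFin \o g) ->
  (forall E, measurable E -> a E + e E = c E + b E)%E ->
  \int[a]_x g x - \int[b]_x g x = \int[c]_x g x - \int[e]_x g x.
Proof.
move=> ia ib ic ie aecb.
have : (\int[measure_add a e]_x (g x)%:E = \int[measure_add c b]_x (g x)%:E)%E.
  apply: eq_measure_integral => E mE _.
  by rewrite [LHS]measure_addE [RHS]measure_addE aecb.
have mg := measurable_int _ ia.
rewrite integral_measure_add// integral_measure_add// => /(congr1 fine).
have fn (m : {measure set T -> \bar R}) : m.-integrable [set: T] (EFin \o g) ->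
    (\int[m]_x (g x)%:E)%E \is a fin_num by exact: integrable_fin_num.
rewrite (fineD (fn _ ia) (fn _ ie)) (fineD (fn _ ic) (fn _ ib)) => H.
by apply/eqP; rewrite subr_eq addrAC eq_sym subr_eq H.
Qed.

Lemma jordanE nu E : measurable E ->
  nu E = (charge_pos nu E - charge_neg nu E)%E.
Proof.
move=> mE; rewrite (jordan_decomp (svalP (hahn nu)) mE)/= /cadd/=.
by rewrite cscaleN1.
Qed.

(** Any splitting of [nu] as a difference of finite measures computes the
    integral: [p - n = a - b] is the equality of measures [p + b = a + n]. *)
Lemma charge_integralE nu (a b : {measure set T -> \bar R}) g :
  (a [set: T] < +oo)%E -> (b [set: T] < +oo)%E ->
  (forall E, measurable E -> nu E = a E - b E)%E -> bounded_measurable g ->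
  charge_integral nu g = \int[a]_x g x - \int[b]_x g x.
Proof.
move=> aT bT nuE bg; rewrite /charge_integral.
have fin (m : {measure set T -> \bar R}) E : (m setT < +oo)%E -> measurable E ->
    m E \is a fin_num.
  move=> mT mE; rewrite ge0_fin_numE//; apply: le_lt_trans mT.
  by apply: le_measure; rewrite ?inE.
apply: Rintegral_measure_eqD => //;
  try (apply: bounded_measurable_integrable => //; exact: finite_measureT).
move=> E mE.
suff : (charge_pos nu E + b E = a E + charge_neg nu E)%E by [].
have := jordanE nu mE; rewrite nuE//.
move: (fin _ _ aT mE) (fin _ _ bT mE).
have := fin _ _ (finite_measureT (charge_pos nu)) mE.
have := fin _ _ (finite_measureT (charge_neg nu)) mE.
move: (a E) (b E) (charge_pos nu E) (charge_neg nu E).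
move=> [u| |] [v| |] [w| |] [z| |]//= _ _ _ _ [H].
have -> : w = u - v + z by rewrite H subrK.
by rewrite -EFinD -EFinD addrAC subrK.
Qed.

Lemma eq_charge_integral nu nu' g : charge_eq nu nu' -> bounded_measurable g ->
  charge_integral nu g = charge_integral nu' g.
Proof.
move=> nunu' bg; rewrite [RHS]/charge_integral.
apply: charge_integralE => //; [exact: finite_measureT..|].
by move=> E mE; rewrite nunu'//; exact: jordanE.
Qed.

Lemma charge_integral_measure (mu : {finite_measure set T -> \bar R}) g :
  bounded_measurable g ->
  charge_integral (charge_of_finite_measure mu) g = \int[mu]_x g x.
Proof.
move=> bg; rewrite (@charge_integralE _ mu mzero)//.
- by rewrite /Rintegral integral_measure_zero subr0.
- exact: finite_measureT.
- by rewrite /mzero ltry.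
- by move=> E mE; rewrite /mzero sube0.
Qed.

End charge_integral_theory.

Section finite_pushforward.
Context {R : realType} {d1 d2 : measure_display}
  {T1 : measurableType d1} {T2 : measurableType d2}.
Variables (f : T1 -> T2) (mf : measurable_fun [set: T1] f)
  (mu : {finite_measure set T1 -> \bar R}).

(** The proof of measurability is an argument so that the structure of finite
    measure can be inferred. *)
Definition push_measure (_ : measurable_fun [set: T1] f) : set T2 -> \bar R :=
  pushforward mu f.

HB.instance Definition _ := Measure.copy (push_measure mf)
  (measure_function_pushforward__canonical__measure_function_Measure mu mf).

Let push_fin_num : fin_num_fun (push_measure mf).
Proof.
move=> E mE; apply: (fin_num_measure mu).
by rewrite -[X in measurable X]setTI; exact: mf.
Qed.

HB.instance Definition _ :=
  Measure_isFinite.Build _ _ _ (push_measure mf) push_fin_num.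

End finite_pushforward.

Lemma bounded_measurable_comp {R : realType} {d d' : measure_display}
    {T : measurableType d} {T' : measurableType d'} (F : T' -> T) (g : T -> R) :
  measurable_fun [set: T'] F -> bounded_measurable g ->
  bounded_measurable (g \o F).
Proof.
move=> mF [mg [C gC]]; split; first exact: measurableT_comp.
by exists C => x; exact: gC.
Qed.

Section charge_integral_linearity.
Context {R : realType} {d : measure_display} {T : measurableType d}.
Implicit Types (nu : {charge set T -> \bar R}) (g : T -> R).

Lemma integral_mscale_EFin (k : {nonneg R}) (mu : {measure set T -> \bar R}) g :
  mu.-integrable [set: T] (EFin \o g) ->
  (\int[mscale k mu]_x (g x)%:E = k%:num%:E * \int[mu]_x (g x)%:E)%E.
Proof.
move=> ig; have mg := measurable_int _ ig.
have mgp := measurable_funepos mg; have mgn := measurable_funeneg mg.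
rewrite [LHS]integralE [X in (_ * X)%E]integralE.
rewrite (ge0_integral_mscale _ _ _ mgp)// (ge0_integral_mscale _ _ _ mgn)//.
rewrite [RHS]muleBr//;
apply: fin_num_adde_defr.
by apply: integrable_fin_num => //; exact: integrable_funepos.
Qed.

Lemma Rintegral_mscale_add (k : {nonneg R})
    (mu nu : {finite_measure set T -> \bar R}) g :
  bounded_measurable g ->
  \int[measure_add (mscale k mu) nu]_x g x =
  k%:num * \int[mu]_x g x + \int[nu]_x g x.
Proof.
move=> bg.
have kT : (mscale k mu [set: T] < +oo)%E by exact: finite_measureT.
have ik := bounded_measurable_integrable kT bg.
have imu := bounded_measurable_integrable (finite_measureT mu) bg.
have inu := bounded_measurable_integrable (finite_measureT nu) bg.
rewrite /Rintegral integral_measure_add// integral_mscale_EFin//.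
rewrite fineD ?fineM//; try exact: integrable_fin_num.
by rewrite -integral_mscale_EFin//; exact: integrable_fin_num.
Qed.

Lemma charge_integral_linear (r : R) nu nu1 nu2 g :
  (forall E, measurable E -> nu E = r%:E * nu1 E + nu2 E)%E ->
  bounded_measurable g ->
  charge_integral nu g = r * charge_integral nu1 g + charge_integral nu2 g.
Proof.
have nonneg_case (k : {nonneg R}) (c c1 c2 : {charge set T -> \bar R}) :
    (forall E, measurable E -> c E = k%:num%:E * c1 E + c2 E)%E ->
    bounded_measurable g ->
    charge_integral c g =
      k%:num * charge_integral c1 g + charge_integral c2 g.
  move=> cE bg.
  have linear_diff (p1 n1 p2 n2 : \bar R) : p1 \is a fin_num ->
      n1 \is a fin_num -> p2 \is a fin_num -> n2 \is a fin_num ->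
      (k%:num%:E * (p1 - n1) + (p2 - n2) =
       k%:num%:E * p1 + p2 - (k%:num%:E * n1 + n2))%E.
    move: p1 n1 p2 n2 => [p1| |] [n1| |] [p2| |] [n2| |]// _ _ _ _.
    by rewrite -!(EFinB, EFinM, EFinD) mulrBr opprD addrACA.
  pose sum (p q : {measure set T -> \bar R}) : {measure set T -> \bar R} :=
    measure_add (mscale k p) q.
  have sumE p q E : (sum p q E = k%:num%:E * p E + q E)%E.
    exact: measure_addE.
  have sumT (p q : {measure set T -> \bar R}) :
      fin_num_fun p -> fin_num_fun q -> (sum p q [set: T] < +oo)%E.
    by move=> pT qT; rewrite sumE ltey_eq fin_numD fin_numM ?pT ?qT.
  rewrite (charge_integralE (a := sum (charge_pos c1) (charge_pos c2))
    (b := sum (charge_neg c1) (charge_neg c2)))//; last 3 first.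
  - by apply: sumT; exact: fin_num_measure.
  - by apply: sumT; exact: fin_num_measure.
  - move=> E mE; rewrite !sumE cE// !jordanE//.
    have fp (c' : {charge set T -> \bar R}) : charge_pos c' E \is a fin_num.
      exact: (fin_num_measure (charge_pos c')).
    have fn (c' : {charge set T -> \bar R}) : charge_neg c' E \is a fin_num.
      exact: (fin_num_measure (charge_neg c')).
    exact: linear_diff.
  by rewrite /sum !Rintegral_mscale_add// /charge_integral mulrBr opprD addrACA.
(* For r < 0, the roles are exchanged: nu2 = (- r) nu1 + nu. *)
move=> nuE bg; have [r0|r0] := leP 0 r.
  exact: (nonneg_case (NngNum r0)).
have Nr0 : 0 <= - r by rewrite oppr_ge0 ltW.
rewrite (nonneg_case (NngNum Nr0) nu2 nu1 nu)/= ?mulNr ?addNKr//.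
move=> E mE; rewrite nuE//.
have n1 : nu1 E \is a fin_num by exact: fin_num_measure.
have n2 : nu2 E \is a fin_num by exact: fin_num_measure.
move: (nu1 E) (nu2 E) n1 n2 => [u| |] [v| |]// _ _.
by rewrite -!(EFinM, EFinD) mulNr addKr.
Qed.

Lemma charge_integral_pushforward d' (T' : measurableType d') (F : T -> T')
    (nu : {charge set T -> \bar R}) (nu' : {charge set T' -> \bar R})
    (g : T' -> R) :
  measurable_fun [set: T] F ->
  (forall E, measurable E -> nu' E = nu (F @^-1` E)) ->
  bounded_measurable g -> charge_integral nu' g = charge_integral nu (g \o F).
Proof.
move=> mF nu'E bg; have bgF := bounded_measurable_comp mF bg.
rewrite (charge_integralE (a := push_measure (charge_pos nu) mF)
  (b := push_measure (charge_neg nu) mF))//; last first.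
- move=> E mE; rewrite nu'E//= jordanE//.
  by rewrite -[X in measurable X]setTI; exact: (mF measurableT).
- exact: finite_measureT.
- exact: finite_measureT.
have pushI (mu : {finite_measure set T -> \bar R}) :
    \int[push_measure mu mF]_x g x = \int[mu]_x g (F x).
  rewrite /Rintegral (integral_pushforward mF)//.
    by apply/measurable_EFinP; case: bg.
  apply: bounded_measurable_integrable => //; exact: finite_measureT.
by rewrite !pushI.
Qed.

End charge_integral_linearity.

Section charge_operations.
Context {R : realType} {d : measure_display} {T : measurableType d}.
Implicit Types (nu : {charge set T -> \bar R}) (g : T -> R).

Lemma charge_integral0 g : bounded_measurable g ->
  charge_integral (czero : {charge set T -> \bar R}) g = 0.
Proof.
move=> bg; rewrite (@charge_integral_linear _ _ _ (-1) czero czero czero)//.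
  by rewrite mulN1r addNr.
by move=> E _; rewrite /czero mule0 adde0.
Qed.

Lemma charge_integral_cscale r nu g : bounded_measurable g ->
  charge_integral (cscale r nu) g = r * charge_integral nu g.
Proof.
move=> bg; rewrite (@charge_integral_linear _ _ _ r _ nu czero)//.
  by rewrite charge_integral0// addr0.
by move=> E _; rewrite /czero adde0.
Qed.

Lemma charge_integral_cadd nu1 nu2 g : bounded_measurable g ->
  charge_integral (cadd nu1 nu2) g =
  charge_integral nu1 g + charge_integral nu2 g.
Proof.
move=> bg; rewrite (@charge_integral_linear _ _ _ 1 _ nu1 nu2) ?mul1r//.
by move=> E _; rewrite mul1e.
Qed.

Lemma charge_integral_copp nu g : bounded_measurable g ->
  charge_integral (copp nu) g = - charge_integral nu g.
Proof.
move=> bg; rewrite (@charge_integral_linear _ _ _ (-1) _ nu czero)//.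
  by rewrite charge_integral0// addr0 mulN1r.
by move=> E _; rewrite /czero adde0 mulN1e.
Qed.

Lemma charge_integral_cst nu r :
  charge_integral nu (fun=> r) = r * fine (nu [set: T]).
Proof.
rewrite /charge_integral !Rintegral_cst// -mulrBr jordanE// fineB//.
- exact: (fin_num_measure (charge_pos nu)).
- exact: (fin_num_measure (charge_neg nu)).
Qed.

End charge_operations.

(** * Measures with a density *)

Section densities.
Context {R : realType} {d : measure_display} {T : measurableType d}.
Variables (nu : {finite_measure set T -> \bar R})
  (m : {sigma_finite_measure set T -> \bar R}) (phi : T -> \bar R).
Hypothesis (iphi : m.-integrable [set: T] phi)
  (nuE : forall A, measurable A -> nu A = (\int[m]_(x in A) phi x)%E).

Lemma density_dominated : nu `<< m.
Proof.
apply/null_content_dominatesP => A mA mA0; rewrite nuE//.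
apply: null_set_integral => //.
exact: measurable_funTS (measurable_int _ iphi).
Qed.

Lemma integral_density (g : T -> \bar R) : nu.-integrable [set: T] g ->
  (\int[nu]_x g x = \int[m]_x (g x * phi x))%E.
Proof.
move=> ig; have numu := density_dominated.
rewrite -(Radon_Nikodym_change_of_variables numu measurableT ig).
have mg := measurable_int _ ig; have mphi := measurable_int _ iphi.
apply: ae_eq_integral => //.
- apply: emeasurable_funM => //.
- exact: emeasurable_funM.
- apply: ae_eqe_mul2l; apply: integral_ae_eq => //.
    exact: Radon_Nikodym_integrable.
  by move=> E _ mE; rewrite -Radon_Nikodym_integral//=; exact: nuE.
Qed.

Lemma density_ge0 : {ae m, forall x, (0 <= phi x)%E}.
Proof.
have numu := density_dominated.
have : ae_eq m [set: T] phi (Radon_Nikodym_SigmaFinite.f nu m).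
  apply: integral_ae_eq => //.
  exact: measurable_int _ (Radon_Nikodym_SigmaFinite.f_integrable numu).
  move=> E _ mE; rewrite -nuE//.
  by rewrite -(Radon_Nikodym_SigmaFinite.f_integral numu).
apply: filterS => x /(_ I) ->; exact: Radon_Nikodym_SigmaFinite.f_ge0.
Qed.

End densities.

Section density_charge_theory.
Context {R : realType} {d : measure_display} {T : measurableType d}.
Variable mu : {finite_measure set T -> \bar R}.
Implicit Types (f g : T -> R).

Lemma density_chargeE f E : bounded_measurable f -> measurable E ->
  density_charge mu f E = (\int[mu]_(x in E) (f x)%:E)%E.
Proof.
move=> bf mE; rewrite /density_charge; case: pselect => [//|[]].
exact: bounded_measurable_integrable (finite_measureT mu) bf.
Qed.

(** On the parts [P] and [N] of a Hahn decomposition, the Jordan components of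
    the charge with density [f] have the densities [f \_ P] and [- f \_ N]. *)
Lemma charge_integral_density f g :
  bounded_measurable f -> bounded_measurable g ->
  charge_integral (density_charge mu f) g = \int[mu]_x (g x * f x).
Proof.
move=> bf bg; rewrite /charge_integral /charge_pos /charge_neg.
case: (hahn _) => -[P N] /= PN; set nu := density_charge mu f in PN *.
have [[mP _] [mN _] PNT PN0] := PN.
have restr_integrable (k : T -> R) D : measurable D -> bounded_measurable k ->
    mu.-integrable [set: T] (EFin \o (k \_ D)).
  move=> mD bk; rewrite -restrict_EFin; apply/(integrable_mkcond _ mD).
  apply: (integrableS measurableT) => //.
  exact: bounded_measurable_integrable (finite_measureT mu) bk.
have jordanI (D : set T) (c : R) (lam : {finite_measure set T -> \bar R}) :
    measurable D -> (forall E, measurable E -> lam E = c%:E * nu (E `&` D))%E ->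
    \int[lam]_x g x = c * \int[mu]_x ((g \* f) \_ D) x.
  move=> mD lamE.
  have bcf : bounded_measurable (fun x => c * f x).
    by apply: bounded_measurableM => //; exact: bounded_measurable_cst.
  rewrite -RintegralZl//; last first.
    by apply: restr_integrable => //; exact: bounded_measurableM.
  rewrite /Rintegral; congr fine.
  rewrite (@integral_density _ _ _ lam mu (EFin \o ((fun x => c * f x) \_ D))).
  - apply: eq_integral => x _; rewrite /= -EFinM /patch.
    by case: ifP => _; rewrite ?mulr0// mulrCA.
  - exact: restr_integrable.
  - move=> A mA; rewrite lamE// /nu density_chargeE//; last exact: measurableI.
    rewrite -restrict_EFin -integral_mkcondr.
    under [RHS]eq_integral do rewrite /= EFinM.
    rewrite integralZl//; first exact: measurableI.
    apply: (integrableS measurableT) => //; first exact: measurableI.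
    exact: bounded_measurable_integrable (finite_measureT mu) bf.
  - exact: bounded_measurable_integrable (finite_measureT lam) bg.
rewrite (jordanI P 1)//; last first.
  move=> E mE; rewrite -[LHS]/(jordan_pos PN E) jordan_posE cjordan_posE.
  by rewrite /crestr0 mem_set// mul1e.
rewrite (jordanI N (-1))//; last first.
  move=> E mE; rewrite -[LHS]/(jordan_neg PN E) jordan_negE cjordan_negE.
  by rewrite /crestr0 mem_set// mulN1e.
rewrite mul1r mulN1r opprK -RintegralD//; last 2 first.
- by apply: restr_integrable => //; exact: bounded_measurableM.
- by apply: restr_integrable => //; exact: bounded_measurableM.
apply: eq_Rintegral => x _; rewrite /patch.
have : (P `|` N) x by rewrite PNT.
have : ~ (P `&` N) x by rewrite PN0.
case: (boolP (x \in P)); case: (boolP (x \in N)); rewrite ?inE ?notin_setE /=.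
- by move=> Nx Px /(_ (conj Px Nx)).
- by rewrite addr0.
- by rewrite add0r.
- by move=> nN nP _ [].
Qed.

End density_charge_theory.

(** * Mixtures of probability measures *)

Section mixture.
Context {R : realType} {dY dZ : measure_display}
  {Y : measurableType dY} {Z : measurableType dZ}.
Variable kappa : Y -> probability Z R.
Hypothesis mkappa : forall E, measurable E ->
  measurable_fun [set: Y] (fun y => kappa y E).

(** Two kernels whose composition is the mixture [\int[l]_y kappa y]: a measure
    is a kernel with source [unit]. *)
Definition weight_kernel (l : {finite_measure set Y -> \bar R}) (_ : unit) :
  {measure set Y -> \bar R} := l.

Section weight_kernel.
Variable l : {finite_measure set Y -> \bar R}.

Let measurable_weight U : measurable U ->
  measurable_fun [set: unit] (weight_kernel l ^~ U).
Proof. by move=> mU; exact: measurable_cst. Qed.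

HB.instance Definition _ :=
  isKernel.Build _ _ _ _ _ (weight_kernel l) measurable_weight.

Let weight_uub : measure_fam_uub (weight_kernel l).
Proof.
exists (fine (l [set: Y]) + 1) => x; rewrite /weight_kernel.
by rewrite EFinD fineK ?fin_num_measure// lteDl// fin_num_measure.
Qed.

HB.instance Definition _ :=
  Kernel_isFinite.Build _ _ _ _ _ (weight_kernel l) weight_uub.

End weight_kernel.

Definition family_kernel (_ : forall E, measurable E ->
    measurable_fun [set: Y] (fun y => kappa y E)) (p : unit * Y) :
  {measure set Z -> \bar R} := kappa p.2.

Let measurable_family_kernel U : measurable U ->
  measurable_fun [set: unit * Y] (family_kernel mkappa ^~ U).
Proof.
by move=> mU; exact: (measurableT_comp (mkappa mU) measurable_snd).
Qed.

HB.instance Definition _ :=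
  isKernel.Build _ _ _ _ _ (family_kernel mkappa) measurable_family_kernel.

Let family_kernel_prob p : family_kernel mkappa p [set: Z] = 1%E.
Proof. exact: probability_setT. Qed.

HB.instance Definition _ :=
  Kernel_isProbability.Build _ _ _ _ _
    (family_kernel mkappa) family_kernel_prob.

Lemma measurable_integral_family (g : Z -> \bar R) :
  (forall z, 0 <= g z)%E -> measurable_fun [set: Z] g ->
  measurable_fun [set: Y] (fun y => \int[kappa y]_z g z)%E.
Proof.
move=> g0 mg.
exact: (@measurable_fun_integral_kernel _ _ _ _ _ kappa mkappa g g0 mg).
Qed.

Lemma integral_mixture (l : {finite_measure set Y -> \bar R})
    (rho : {measure set Z -> \bar R}) (g : Z -> \bar R) :
  (forall E, measurable E -> rho E = \int[l]_y kappa y E)%E ->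
  (forall z, 0 <= g z)%E -> measurable_fun [set: Z] g ->
  (\int[rho]_z g z = \int[l]_y \int[kappa y]_z g z)%E.
Proof.
move=> rhoE g0 mg.
rewrite -(integral_kcomp (weight_kernel l) (family_kernel mkappa) tt g0 mg).
by apply: eq_measure_integral => E mE _; rewrite rhoE.
Qed.

End mixture.

Lemma normr_Rintegral_probability {R : realType} {d : measure_display}
    {T : measurableType d} (mu : probability T R) (g : T -> R) (C : R) :
  measurable_fun [set: T] g -> (forall x, `|g x| <= C) ->
  `|\int[mu]_x g x| <= C.
Proof.
move=> mg gC.
have bg : bounded_measurable g by split; last exists C.
have ig := bounded_measurable_integrable (finite_measureT mu) bg.
have bC := @bounded_measurable_cst R d T C.
have iC := bounded_measurable_integrable (finite_measureT mu) bC.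
apply: le_trans (le_normr_Rintegral measurableT ig) _.
apply: le_trans (le_Rintegral (f2 := fun=> C) measurableT _ iC _) _ => //.
- by move/integrable_norm : ig; apply: eq_integrable.
- by rewrite Rintegral_cst// [X in fine X]probability_setT mulr1.
Qed.

Lemma RintegralD_cst {R : realType} (d : measure_display)
    (T : measurableType d)
    (mu : {finite_measure set T -> \bar R}) (g : T -> R) (C : R) :
  bounded_measurable g ->
  \int[mu]_z (g z + C) = \int[mu]_z g z + C * fine (mu [set: T]).
Proof.
move=> bg; rewrite RintegralD//; first by rewrite Rintegral_cst.
  exact: bounded_measurable_integrable (finite_measureT mu) bg.
exact: bounded_measurable_integrable (finite_measureT mu)
  (bounded_measurable_cst C).
Qed.

Section bounded_mixture.
Context {R : realType} {dY dZ : measure_display}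
  {Y : measurableType dY} {Z : measurableType dZ}.
Variable kappa : Y -> probability Z R.
Hypothesis mkappa : forall E, measurable E ->
  measurable_fun [set: Y] (fun y => kappa y E).

(** Adding a bound of [g] reduces this lemma and the next one to nonnegative
    functions, since every [kappa y] has mass 1. *)
Lemma bounded_measurable_mixture (g : Z -> R) : bounded_measurable g ->
  bounded_measurable (fun y => \int[kappa y]_z g z).
Proof.
move=> [mg [C gC]]; split; last first.
  by exists C => y; exact: normr_Rintegral_probability.
have bg : bounded_measurable g by split; last exists C.
rewrite (_ : (fun _ => _) = (fun y => \int[kappa y]_z (g z + C) - C)).
  apply: measurable_funB => //.
  apply: (measurableT_comp (fine_measurable _)) => //.
  apply: (measurable_integral_family mkappa).
    move=> z; rewrite lee_fin -lerBlDr sub0r.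
    by have := gC z; rewrite ler_norml => /andP[].
  by apply/measurable_EFinP; exact: measurable_funD.
apply/funext => y.
rewrite (RintegralD_cst (kappa y))//.
by rewrite [X in fine X]probability_setT mulr1 addrK.
Qed.

Lemma Rintegral_mixture (l : {finite_measure set Y -> \bar R})
    (rho : {finite_measure set Z -> \bar R}) (g : Z -> R) :
  (forall E, measurable E -> rho E = \int[l]_y kappa y E)%E ->
  bounded_measurable g ->
  \int[rho]_z g z = \int[l]_y \int[kappa y]_z g z.
Proof.
move=> rhoE bg; have bI := bounded_measurable_mixture bg.
have [mg [C gC]] := bg.
have rhoT : rho [set: Z] = l [set: Y].
  rewrite rhoE//; under eq_integral do rewrite probability_setT.
  by rewrite integral_cst// mul1e.
apply: (addIr (C * fine (rho [set: Z]))).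
rewrite -(RintegralD_cst rho)// rhoT -(RintegralD_cst l)//.
rewrite /Rintegral (integral_mixture mkappa rhoE)//; last 2 first.
- move=> z; rewrite lee_fin -lerBlDr sub0r.
  by have := gC z; rewrite ler_norml => /andP[].
- by apply/measurable_EFinP; exact: measurable_funD.
congr fine; apply: eq_integral => y _.
transitivity ((\int[kappa y]_z (g z + C))%:E).
  rewrite /Rintegral fineK//; apply: integrable_fin_num => //.
  apply: bounded_measurable_integrable (finite_measureT (kappa y)) _.
  split; first exact: measurable_funD.
  by exists (C + `|C|) => z; rewrite (le_trans (ler_normD _ _))// lerD2r.
by rewrite (RintegralD_cst (kappa y))// [X in fine X]probability_setT mulr1.
Qed.

End bounded_mixture.

(** * Integration along the leaves *)

Section leafwise.
Context {R : realType} {X K : pmetricType R}.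
Local Notation XK := (borel X * borel K)%type.
Variable m : probability (borel X) R.

Lemma measurable_leaf (x : X) : measurable (leaf x : set XK).
Proof.
have mx : measurable ([set x] : set (borel X)).
  rewrite -[X in measurable X]setCK; apply: measurableC.
  apply: sub_sigma_algebra; rewrite /= openC.
  by apply: accessible_closed_set1; exact/hausdorff_accessible/metric_hausdorff.
have := @measurable_fst _ _ (borel X) (borel K) measurableT _ mx.
by rewrite setTI.
Qed.

Lemma measurable_snd_at (x : X) :
  measurable_fun [set: XK] (fun p => (x, p.2) : XK).
Proof. exact: measurable_fun_pair (measurable_cst _) measurable_snd. Qed.

Lemma Rintegral_leaf (k : probability XK R) (x : X) (h : XK -> R) :
  k (leaf x) = 1%E -> bounded_measurable h ->
  \int[k]_p h p = \int[k]_p h (x, p.2).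
Proof.
move=> kx bh.
have bhx := bounded_measurable_comp (measurable_snd_at x) bh.
congr fine; apply: ae_eq_integral => //.
- by apply/measurable_EFinP; case: bh.
- by apply/measurable_EFinP; case: bhx.
exists (~` leaf x); split.
- by apply: measurableC; exact: measurable_leaf.
- rewrite [LHS]probability_setC; first by rewrite kx subee.
  exact: measurable_leaf.
- by move=> [x' y] /= + xx'; apply => _; rewrite /leaf /= in xx'; rewrite xx'.
Qed.

Lemma charge_integral_leaf_restriction (mu : {finite_measure set XK -> \bar R})
    (kappa : borel X -> probability XK R) (x : borel X) (g : borel K -> R) :
  bounded_measurable g ->
  charge_integral (leaf_restriction m mu kappa x) g =
  fine (marginal_density m (charge_of_finite_measure mu) x) *
  \int[kappa x]_p g p.2.
Proof.
move=> bg; rewrite charge_integral_cscale//; congr (_ * _).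
rewrite (charge_integral_pushforward (nu := charge_of_finite_measure (kappa x))
  measurable_snd)//.
rewrite charge_integral_measure//.
exact: bounded_measurable_comp measurable_snd bg.
Qed.

End leafwise.

Section disintegration.
Context {R : realType} {X K : pmetricType R}.
Local Notation XK := (borel X * borel K)%type.
Variable m : probability (borel X) R.

Section positive_measure.
Variables (mu : {finite_measure set XK -> \bar R})
  (kappa : borel X -> probability XK R).
Hypotheses (mu_ac : marginal (charge_of_finite_measure mu) `<< m)
  (mu_kappa : is_disintegration m mu kappa).

Let phi : borel X -> \bar R := marginal_density m (charge_of_finite_measure mu).
Let base : {finite_measure set (borel X) -> \bar R} :=
  push_measure mu measurable_fst.

Let iphi : m.-integrable [set: borel X] phi.
Proof. exact: Radon_Nikodym_integrable. Qed.

Let baseE A : measurable A -> base A = (\int[m]_(x in A) phi x)%E.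
Proof. by move=> mA; rewrite -Radon_Nikodym_integral. Qed.

Let phi_fin x : phi x \is a fin_num.
Proof. exact: Radon_Nikodym_fin_num. Qed.

(** The kernels sit on their leaves outside a set that is null for the marginal
    of [mu]; this set may have positive [m]-measure, but the density [phi]
    vanishes almost everywhere on it. *)
Lemma disintegration_leaf (h : XK -> R) : bounded_measurable h ->
  {ae m, forall x, fine (phi x) * \int[kappa x]_p h p =
                   fine (phi x) * \int[kappa x]_p h (x, p.2)}.
Proof.
move=> bh; have [[D [mD D0 leafD]] _ _] := mu_kappa.
have phi0 : ae_eq m D phi (cst 0%E).
  have mphi := measurable_funTS (measurable_int _ iphi) : measurable_fun D phi.
  apply/(ae_eq_integral_abs _ mD mphi).
  rewrite -[RHS]D0 -[RHS]/(base D) baseE//.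
  apply: ae_eq_integral => //; first exact: measurableT_comp.
  apply: filterS (density_ge0 iphi baseE) => x phix _.
  by rewrite gee0_abs.
apply: filterS phi0 => x phix.
have [Dx|Dx] := pselect (D x); first by rewrite (phix Dx)/= !mul0r.
rewrite (@Rintegral_leaf _ _ _ (kappa x) x h)//.
by apply: contra_notP Dx => nleaf; exact: leafD.
Qed.

Lemma integrable_disintegration (h : XK -> R) : bounded_measurable h ->
  m.-integrable [set: borel X]
    (EFin \o (fun x => fine (phi x) * \int[kappa x]_p h p)).
Proof.
move=> bh; have [_ mkappa _] := mu_kappa.
have [mI [C IC]] := bounded_measurable_mixture mkappa bh.
have iCphi : m.-integrable [set: borel X] (fun x => `|C|%:E * phi x)%E.
  exact: integrableZl.
apply: le_integrable iCphi => //.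
  apply/measurable_EFinP; apply: measurable_funM => //.
  apply: (measurableT_comp (fine_measurable _)) => //.
  exact: measurable_int iphi.
move=> x _; rewrite /= -(fineK (phi_fin x)) -EFinM lee_fin /= !normrM normr_id.
rewrite mulrC; apply: ler_wpM2r => //.
exact: le_trans (IC x) (ler_norm _).
Qed.

(** The density turns integrals against [m] into integrals against the marginal
    [base], of which [mu] is then a mixture. *)
Lemma Rintegral_disintegration (h : XK -> R) : bounded_measurable h ->
  \int[mu]_p h p = \int[m]_x (fine (phi x) * \int[kappa x]_p h p).
Proof.
move=> bh; have [_ mkappa muE] := mu_kappa.
have mixed E : measurable E -> mu E = (\int[base]_x kappa x E)%E.
  move=> mE; rewrite (integral_density iphi baseE) ?muE//.
  apply: (eq_integrable measurableT (EFin \o (fun x => fine (kappa x E)))).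
    by move=> x _; rewrite /= fineK// fin_num_measure.
  apply: bounded_measurable_integrable (finite_measureT base) _; split.
    by apply: (measurableT_comp (fine_measurable _)) => //; exact: mkappa.
  exists 1 => x; rewrite ger0_norm ?fine_ge0//.
  rewrite -lee_fin fineK ?fin_num_measure//.
  exact: probability_le1.
rewrite (Rintegral_mixture mkappa mixed bh).
have bI := bounded_measurable_mixture mkappa bh.
rewrite /Rintegral (integral_density iphi baseE).
  congr fine; apply: eq_integral => x _.
  by rewrite [RHS]EFinM [in RHS]fineK// [RHS]muleC.
exact: bounded_measurable_integrable (finite_measureT base) bI.
Qed.

End positive_measure.

(** On almost every leaf, [h] divided by [C] is a test function of [wnorm];
    integrating the leafwise bound costs no factor because [m] is a
    probability. *)
Lemma normr_charge_integral_le (nu : {charge set XK -> \bar R}) (h : XK -> R)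
    (C : R) :
  in_AB m nu -> bounded_measurable h -> 0 < C -> (forall p, `|h p| <= C) ->
  (forall x y1 y2, `|h (x, y1) - h (x, y2)| <= C * mdist (y1 : K) y2) ->
  (`|charge_integral nu h|%:E <= C%:E * norm_infty m nu)%E.
Proof.
move=> [acp acn] bh C0 hC hLip.
rewrite -lee_pdivrMl//; apply: le_ereal_inf_tmp => s [kp [kn [dp dn ->{s}]]].
rewrite lee_pdivrMl//.
set w := fun x => wnorm (signed_leaf_restriction m nu kp kn x).
set Dp := fun x : borel X =>
  fine (marginal_density m (charge_of_finite_measure (charge_pos nu)) x) *
  \int[kp x]_p h p.
set Dn := fun x : borel X =>
  fine (marginal_density m (charge_of_finite_measure (charge_neg nu)) x) *
  \int[kn x]_p h p.
have iDp : m.-integrable [set: borel X] (EFin \o Dp).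
  exact: (integrable_disintegration acp dp bh).
have iDn : m.-integrable [set: borel X] (EFin \o Dn).
  exact: (integrable_disintegration acn dn bh).
have -> : charge_integral nu h = \int[m]_x (Dp x - Dn x).
  rewrite RintegralB// /charge_integral.
  rewrite (Rintegral_disintegration acp dp bh).
  by rewrite (Rintegral_disintegration acn dn bh).
have w0 x : (0 <= w x)%E.
  apply: ereal_sup_ubound; exists (fun=> 0).
    by split => *; rewrite ?subrr normr0// mdist_ge0.
  by rewrite charge_integral_cst mul0r normr0.
have Dw : {ae m, forall x, (`|Dp x - Dn x|%:E <= C%:E * w x)%E}.
  apply: filterS2 (disintegration_leaf acp dp bh)
    (disintegration_leaf acn dn bh).
  move=> x; rewrite -/(Dp x) -/(Dn x) => -> ->.
  pose g (y : borel K) := C^-1 * h (x, y).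
  have bhx : bounded_measurable (fun y : borel K => h (x, y)).
    apply: (bounded_measurable_comp _ bh).
    exact: measurable_fun_pair (measurable_cst _) (@measurable_id _ _ _).
  have bg : bounded_measurable g.
    by apply: bounded_measurableM => //; exact: bounded_measurable_cst.
  rewrite -lee_pdivrMl//; apply: ereal_sup_ubound; exists g.
    split=> [y1 y2|y].
      rewrite -mulrBr normrM gtr0_norm ?invr_gt0// ler_pdivrMl//.
    by rewrite normrM gtr0_norm ?invr_gt0// ler_pdivrMl// mulr1.
  rewrite /signed_leaf_restriction charge_integral_cadd//.
  rewrite charge_integral_copp//.
  rewrite !charge_integral_leaf_restriction// -EFinM; congr EFin.
  have scale (k : probability XK R) :
      \int[k]_p g p.2 = C^-1 * \int[k]_p h (x, p.2).
    rewrite -RintegralZl//.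
    apply: bounded_measurable_integrable (finite_measureT k) _.
    exact: (bounded_measurable_comp (measurable_snd_at x) bh).
  rewrite !scale ![fine _ * (C^-1 * _)]mulrCA -mulrBr normrM.
  by rewrite gtr0_norm// invr_gt0.
have mT : (0 < m [set: borel X])%E by rewrite probability_setT lte01.
have s0 : (0 <= ess_sup m w)%E.
  by apply: ess_sup_gee => //; exact: nearW.
case sE : (ess_sup m w) s0 => [s| |]// s0; last first.
  by rewrite gt0_muley// ?leey ?lte_fin.
rewrite -EFinM.
have iD : m.-integrable [set: borel X] (EFin \o (Dp \- Dn)).
  exact: (integrableB measurableT iDp iDn).
rewrite EFin_normr_Rintegral//.
apply: (le_trans (le_abse_integral m measurableT (measurable_int _ iD))).
have -> : (C * s)%:E = (\int[m]_x (C * s)%:E)%E.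
  by rewrite integral_cst// [X in (_ * X)%E]probability_setT mule1.
apply: ae_ge0_le_integral => //.
- by apply: measurableT_comp => //; exact: measurable_int _ iD.
- by move=> x _; rewrite lee_fin mulr_ge0// ltW.
apply: filterS2 Dw (ess_sup_ge m w) => x Dx wx _.
apply: le_trans Dx _; rewrite EFinM; apply: lee_wpmul2l; first exact/ltW.
by rewrite -sE.
Qed.

End disintegration.

(** * Borel measurability on the shift space and the skew product *)

Section metric_borel.
Context {R : realType}.

Lemma open_mdistP (X : pmetricType R) (A : set X) :
  open A <-> forall x, A x -> exists2 e : R, 0 < e &
    forall y, mdist x y < e -> A y.
Proof.
rewrite openE; split=> [oA x Ax|A_ x Ax].
  have /nbhs_ballP[e /= e0 eA] := oA _ Ax.
  by exists e => // y xy; apply: eA; rewrite ballEmdist.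
have [e e0 eA] := A_ _ Ax; apply/nbhs_ballP; exists e => //= y.
by rewrite ballEmdist => /eA.
Qed.

Lemma measurable_lipschitz (X : pmetricType R) (f : borel X -> R) (L : R) :
  (forall x y, `|f x - f y| <= L * mdist (x : X) y) ->
  measurable_fun [set: borel X] f.
Proof.
move=> fL.
apply: (measurability _ (RGenOInfty.measurableE R)) => _ /= -[_ [r ->] <-].
rewrite setTI; apply: sub_sigma_algebra; apply/open_mdistP => x.
rewrite /= in_itv/= andbT => rx.
have d0 : 0 < `|L| + 1 by rewrite ltr_wpDl.
exists ((f x - r) / (`|L| + 1)); first by rewrite divr_gt0// subr_gt0.
move=> y; rewrite ltr_pdivlMr// => xy; rewrite /= in_itv/= andbT.
have : f x - f y < f x - r; last by rewrite ltrD2l ltrN2.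
apply: le_lt_trans xy; rewrite mulrC; apply: le_trans (ler_norm _) _.
apply: le_trans (fL x y) _; apply: ler_wpM2r; first exact: mdist_ge0.
by rewrite (le_trans (ler_norm _))// lerDl.
Qed.

Lemma measurable_lipschitz_map (X Y : pmetricType R) (f : borel X -> borel Y)
    (L : R) :
  0 < L -> (forall x y, mdist (f x : Y) (f y) <= L * mdist (x : X) y) ->
  measurable_fun [set: borel X] f.
Proof.
move=> L0 fL.
apply: (@measurability _ _ (borel X) (borel Y) _ _ (@open Y)) => //.
move=> _ [U oU <-]; rewrite setTI; apply: sub_sigma_algebra.
apply/open_mdistP => x /= Ux; have [e e0 Ue] := (open_mdistP U).1 oU _ Ux.
exists (e / L) => [|y]; first by rewrite divr_gt0.
by rewrite ltr_pdivlMr// mulrC => /(le_lt_trans (fL x y)); exact: Ue.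
Qed.

End metric_borel.

Section shift_space_geometry.
Context {R : realType} {N0 : nat} {A : aperiodic_matrix N0}
  {theta : {itv R & `]0%Z, 1%Z[}}.
Local Notation X := (shift_space A theta).
Local Notation t := (theta%:num : R).

Let t_gt0 : 0 < t. Proof. by []. Qed.
Let t_lt1 : t < 1. Proof. by []. Qed.

Lemma d_theta_ge0 (x y : X) : 0 <= d_theta x y.
Proof. exact: (mdist_ge0 (x : X) y). Qed.

Lemma d_theta_le (x y : X) : d_theta x y <= (1 - t)^-1.
Proof.
have cg : series (geometric 1 t) @ \oo --> (1 - t)^-1.
  rewrite -[X in _ --> X]mul1r.
  by apply: cvg_geometric_series; rewrite ger0_norm.
rewrite -(cvg_lim (@Rhausdorff R) cg); apply: lim_series_le.
- exact: d_theta_cvg.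
- exact: cvgP cg.
- move=> n; rewrite /geometric/= mul1r ler_piMr ?exprn_ge0//.
  by case: (x n != y n).
Qed.

(** Induction on this identity gives both estimates comparing [d_theta] with
    the length of the common prefix. *)
Lemma d_theta_shift (x y : X) :
  d_theta x y = (x 0%N != y 0%N)%:R + t * d_theta (Defs.shift x) (Defs.shift y).
Proof.
rewrite {1}/d_theta; apply/(cvg_lim (@Rhausdorff R)).
rewrite -cvg_shiftS.
rewrite (_ : [sequence _]_n = (fun n => (x 0%N != y 0%N)%:R + t *
  series (fun i => t ^+ i * (Defs.shift x i != Defs.shift y i)%:R) n)).
  by apply: cvgD; [exact: cvg_cst|apply: cvgMl_tmp; exact: d_theta_cvg].
apply/funext => n; rewrite /series/= big_nat_recl//= expr0 mul1r; congr (_ + _).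
by rewrite mulr_sumr; apply: eq_bigr => i _; rewrite exprS mulrA.
Qed.

Lemma d_theta_agree n (x y : X) : (forall i, (i < n)%N -> x i = y i) ->
  d_theta x y <= t ^+ n * (1 - t)^-1.
Proof.
elim: n x y => [|n IHn] x y xy; first by rewrite expr0 mul1r; exact: d_theta_le.
rewrite d_theta_shift xy// eqxx add0r exprS -mulrA ler_wpM2l//; apply: IHn.
by move=> i ni; exact: xy.
Qed.

Lemma d_theta_disagree i (x y : X) : d_theta x y < t ^+ i -> x i = y i.
Proof.
move=> xy; apply/eqP/negPn/negP => xyi; move: xy; rewrite ltNge => /negP; apply.
elim: i x y xyi => [|i IHi] x y xyi; rewrite d_theta_shift.
  by rewrite xyi expr0 lerDl mulr_ge0// d_theta_ge0.
have IH := IHi (Defs.shift x) (Defs.shift y) xyi.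
by rewrite exprS (le_trans (ler_wpM2l _ IH))// lerDr.
Qed.

Lemma measurable_shift :
  measurable_fun [set: borel X] (@Defs.shift R N0 A theta : borel X -> borel X).
Proof.
apply: (@measurable_lipschitz_map _ _ _ _ (t^-1)); first by rewrite invr_gt0.
move=> x y; rewrite ler_pdivlMl//.
by rewrite [leRHS](d_theta_shift x y) lerDr.
Qed.

Definition prefix n (x : X) : {ffun 'I_n -> 'I_N0} := [ffun i : 'I_n => x i].

Lemma measurable_cylinder n (w : {ffun 'I_n -> 'I_N0}) :
  measurable ([set x | prefix n x = w] : set (borel X)).
Proof.
apply: sub_sigma_algebra; apply/open_mdistP => x /= xw.
exists (t ^+ n) => [|y xy]; first exact: exprn_gt0.
rewrite -xw; apply/ffunP => i; rewrite !ffunE; apply/esym/d_theta_disagree.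
by apply: lt_le_trans xy _; rewrite ler_wiXn2l// ltnW.
Qed.

End shift_space_geometry.

Section lipschitz_norm.
Context {R : realType} {T : pointedType}.
Variable dist : T -> T -> R.
Hypothesis dist_ge0 : forall x y, 0 <= dist x y.
Implicit Types f : T -> R.

Lemma lip_const_ge0 f : (0 <= lip_const dist f)%E.
Proof. by apply: le_ereal_inf_tmp => _ [L [L0 _] <-]; rewrite lee_fin. Qed.

Lemma sup_norm_ge0 f : (0 <= sup_norm f)%E.
Proof.
apply: (@le_trans _ _ `|f point|%:E); first by rewrite lee_fin.
by apply: ereal_sup_ubound; exists point.
Qed.

Lemma lip_norm_ge0 f : (0 <= lip_norm dist f)%E.
Proof. by rewrite adde_ge0// ?sup_norm_ge0// lip_const_ge0. Qed.

Lemma lip_const_fin_num f :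
  is_lipschitz dist f -> lip_const dist f \is a fin_num.
Proof. by move=> fL; rewrite ge0_fin_numE// lip_const_ge0. Qed.

Lemma lip_constP f x y : is_lipschitz dist f ->
  `|f x - f y| <= fine (lip_const dist f) * dist x y.
Proof.
move=> fL; have fLfin := lip_const_fin_num fL.
have [d0|d0] := eqVneq (dist x y) 0.
  have [_ [L [L0 Lf] _] _] := ereal_inf_lt fL.
  by apply: le_trans (Lf x y) _; rewrite d0 !mulr0.
have dpos : 0 < dist x y by rewrite lt_neqAle eq_sym d0 dist_ge0.
rewrite -ler_pdivrMr// -lee_fin fineK//; apply: le_ereal_inf_tmp.
by move=> _ [L [L0 Lf] <-]; rewrite lee_fin ler_pdivrMr.
Qed.

Lemma sup_norm_lty f (C : R) : (forall x, `|f x| <= C) -> (sup_norm f < +oo)%E.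
Proof.
move=> fC; apply: (@le_lt_trans _ _ C%:E); last exact: ltry.
by apply: ge_ereal_sup => _ [x _ <-]; rewrite lee_fin.
Qed.

Lemma lip_norm_fin_num f (C : R) : is_lipschitz dist f ->
  (forall x, `|f x| <= C) -> lip_norm dist f \is a fin_num.
Proof.
move=> fL fC; rewrite fin_numD lip_const_fin_num// andbT.
by rewrite ge0_fin_numE ?sup_norm_ge0//; exact: sup_norm_lty fC.
Qed.

Lemma normr_le_lip_norm f (C : R) x : is_lipschitz dist f ->
  (forall x, `|f x| <= C) -> `|f x| <= fine (lip_norm dist f).
Proof.
move=> fL fC; rewrite -lee_fin fineK ?(lip_norm_fin_num fL fC)//.
rewrite -[leLHS]adde0; apply: leeD; last exact: lip_const_ge0.
by apply: ereal_sup_ubound; exists x.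
Qed.

Lemma normrB_le_lip_norm f (C : R) x y : is_lipschitz dist f ->
  (forall x, `|f x| <= C) ->
  `|f x - f y| <= fine (lip_norm dist f) * dist x y.
Proof.
move=> fL fC; apply: le_trans (lip_constP x y fL) _; apply: ler_wpM2r => //.
apply: fine_le; rewrite ?lip_const_fin_num ?(lip_norm_fin_num fL fC)//.
by rewrite -[leLHS]add0e; apply: leeD => //; exact: sup_norm_ge0.
Qed.

Lemma lipschitz_bounded f (D : R) : (forall x y, dist x y <= D) ->
  is_lipschitz dist f -> exists C : R, forall x, `|f x| <= C.
Proof.
move=> dD fL; exists (`|f point| + fine (lip_const dist f) * D) => x.
rewrite -[f x](subrK (f point)) (le_trans (ler_normD _ _))// addrC lerD2l.
apply: le_trans (lip_constP x point fL) _; apply: ler_wpM2l => //.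
by rewrite fine_ge0// lip_const_ge0.
Qed.

End lipschitz_norm.

Section skew_product_theory.
Context {R : realType} {N0 : nat} {A : aperiodic_matrix N0}
  {theta : {itv R & `]0%Z, 1%Z[}} {K : pmetricType R}.
Local Notation X := (shift_space A theta).
Local Notation XK := (borel X * borel K)%type.
Local Notation t := (theta%:num : R).

Lemma sum_dist_ge0 (p q : XK) : 0 <= sum_dist p q.
Proof. by rewrite addr_ge0// mdist_ge0. Qed.

Lemma sum_dist_le (p q : XK) : diam K = 1%:E -> sum_dist p q <= (1 - t)^-1 + 1.
Proof.
move=> K1; apply: lerD; first exact: d_theta_le.
rewrite -lee_fin -K1; apply: ereal_sup_ubound.
by exists p.2 => //; exists q.2.
Qed.

(** Measurability refers to the sigma-algebra generated by the rectangles.  The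
    cylinders of length [n] are finitely many and shrink as [n] grows: with one
    point [c] chosen in each of them, [h] is the limit of the functions equal to
    [h (c, y)] over the cylinder of [c]. *)
Lemma measurable_lipschitz_product (h : XK -> R) :
  is_lipschitz sum_dist h -> measurable_fun [set: XK] h.
Proof.
move=> hL; set L := fine (lip_const sum_dist h).
have L0 : 0 <= L by rewrite fine_ge0// lip_const_ge0.
have hP p q : `|h p - h q| <= L * sum_dist p q.
  exact: (lip_constP (@sum_dist_ge0) p q hL).
pose c n (w : {ffun 'I_n -> 'I_N0}) : X :=
  xget point [set x | prefix n x = w].
pose hn n (p : XK) : R := \sum_(w : {ffun 'I_n -> 'I_N0})
  \1_[set x : borel X | prefix n x = w] p.1 * h (c n w, p.2).
have hnE n p : hn n p = h (c n (prefix n p.1), p.2).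
  rewrite /hn (bigD1 (prefix n p.1))//= indicE mem_set// mul1r big1 ?addr0//.
  move=> w /eqP wp; rewrite indicE memNset ?mul0r//= => /esym; exact: wp.
have dc n (x : X) : d_theta (c n (prefix n x)) x <= t ^+ n * (1 - t)^-1.
  apply: d_theta_agree => i ni.
  have : prefix n (c n (prefix n x)) = prefix n x.
    by rewrite /c; case: xgetP => [y -> //|/(_ x)]; case.
  by move=> /ffunP/(_ (Ordinal ni)); rewrite !ffunE.
apply: (measurable_fun_cvg (h := hn)) => [n|p _].
  apply: measurable_sum => w; apply: measurable_funM.
    apply: measurableT_comp measurable_fst.
    by apply: measurable_indic; exact: measurable_cylinder.
  have mhc : measurable_fun [set: borel K] (fun y => h (c n w, y)).
    apply: (@measurable_lipschitz _ _ _ L) => y1 y2.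
    by apply: le_trans (hP _ _) _; rewrite /sum_dist/= mdistxx add0r.
  exact: (measurableT_comp mhc measurable_snd).
have cvg0 : (fun n => L * (1 - t)^-1 * t ^+ n) @ \oo --> (0 : R).
  by apply: cvg_geometric; rewrite ger0_norm.
apply/cvgrPdist_le => e e0; move/cvgrPdist_le : cvg0 => /(_ _ e0).
apply: filterS => n /=; rewrite sub0r normrN => Le.
rewrite hnE distrC; apply: le_trans (hP _ _) _; apply: le_trans Le.
apply: le_trans (ler_norm _); rewrite -mulrA; apply: ler_wpM2l => //.
by rewrite /sum_dist/= mdistxx addr0 mulrC; exact: dc.
Qed.

Lemma bounded_measurable_lipschitz (h : XK -> R) :
  diam K = 1%:E -> is_lipschitz sum_dist h -> bounded_measurable h.
Proof.
move=> K1 hL; split; first exact: measurable_lipschitz_product.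
apply: (lipschitz_bounded (@sum_dist_ge0) _ hL) => p q.
exact: sum_dist_le.
Qed.

Lemma measurable_skew_product (G : XK -> borel K) :
  measurable_fun [set: XK] G -> measurable_fun [set: XK] (skew_product G).
Proof.
move=> mG; apply: measurable_fun_pair => //.
exact: measurableT_comp measurable_shift measurable_fst.
Qed.

End skew_product_theory.

(** * The strong space and the spectral gap *)

Section strong_norm.
Context {R : realType} {X K : pmetricType R}.
Local Notation XK := (borel X * borel K)%type.
Variable m : probability (borel X) R.
Implicit Types mu : {charge set XK -> \bar R}.

Lemma norm_infty_ge0 mu : (0 <= norm_infty m mu)%E.
Proof.
apply: le_ereal_inf_tmp => s [kp [kn [_ _ ->{s}]]].
apply: ess_sup_gee; first by rewrite [ltRHS]probability_setT lte01.
apply: nearW => x; apply: ereal_sup_ubound; exists (fun=> 0).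
  by split => *; rewrite ?subrr normr0// mdist_ge0.
by rewrite charge_integral_cst mul0r normr0.
Qed.

Lemma density_norm_ge0 mu : (0 <= density_norm m mu)%E.
Proof. by apply: le_ereal_inf_tmp => _ [phi _ <-]; exact: lip_norm_ge0. Qed.

Lemma norm_Sinfty_ge0 mu : (0 <= norm_Sinfty m mu)%E.
Proof. by rewrite adde_ge0// ?norm_infty_ge0// density_norm_ge0. Qed.

Lemma norm_infty_le_Sinfty mu : (norm_infty m mu <= norm_Sinfty m mu)%E.
Proof.
by rewrite -[leLHS]add0e; apply: leeD => //; exact: density_norm_ge0.
Qed.

Lemma in_Sinfty_norm_lty mu : in_AB m mu -> (norm_Sinfty m mu < +oo)%E ->
  in_Sinfty m mu.
Proof.
move=> ABmu muoo; split.
  by split => //; apply: le_lt_trans (norm_infty_le_Sinfty mu) muoo.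
have : (density_norm m mu < +oo)%E.
  apply: le_lt_trans muoo; rewrite -[leLHS]adde0.
  by apply: leeD => //; exact: norm_infty_ge0.
move=> /ereal_inf_lt[_ [phi vphi <-] phioo]; exists phi => //.
apply: le_lt_trans phioo; rewrite -[leLHS]add0e.
by apply: leeD => //; exact: sup_norm_ge0.
Qed.

Lemma norm_Sinfty_lty mu (D : R) : (forall x y : X, mdist x y <= D) ->
  in_Sinfty m mu -> (norm_Sinfty m mu < +oo)%E.
Proof.
move=> XD [[_ muoo] [phi vphi phiL]]; apply: lte_add_pinfty => //.
have [C phiC] := lipschitz_bounded (@mdist_ge0 R X) XD phiL.
apply: (@le_lt_trans _ _ (lip_norm mdist phi)).
  by apply: ereal_inf_lbound; exists phi.
by rewrite ltey_eq (lip_norm_fin_num phiL phiC).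
Qed.

(** A set that is null for the marginals of both Jordan components of [mu] is
    null for that of [mu], hence for any measure with a density. *)
Lemma in_AB_density (mu : {finite_measure set XK -> \bar R}) (f : XK -> R) :
  bounded_measurable f -> in_AB m (charge_of_finite_measure mu) ->
  in_AB m (density_charge mu f).
Proof.
move=> bf [/null_content_dominatesP acp /null_content_dominatesP acn].
have dom : density_charge mu f `<< mu.
  apply/null_content_dominatesP => E mE E0; rewrite density_chargeE//.
  apply: null_set_integral => //; apply: measurable_funTS.
  by apply/measurable_EFinP; case: bf.
have mu0 B : measurable B -> m B = 0%E -> mu (fst @^-1` B) = 0%E.
  move=> mB mB0.
  have mfB : measurable (fst @^-1` B : set XK).
    by rewrite -[X in measurable X]setTI; exact: measurable_fst.
  rewrite -[LHS]/(charge_of_finite_measure mu _) jordanE//.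
  have -> : charge_pos (charge_of_finite_measure mu) (fst @^-1` B) = 0%E.
    exact: acp.
  have -> : charge_neg (charge_of_finite_measure mu) (fst @^-1` B) = 0%E.
    exact: acn.
  by rewrite sube0.
split; apply/null_content_dominatesP => B mB mB0.
  have /null_content_dominatesP := jordan_pos_dominates
    (svalP (hahn (density_charge mu f))) dom.
  apply; last exact: mu0.
  by rewrite -[X in measurable X]setTI; exact: measurable_fst.
have /null_content_dominatesP := jordan_neg_dominates
  (svalP (hahn (density_charge mu f))) dom.
apply; last exact: mu0.
by rewrite -[X in measurable X]setTI; exact: measurable_fst.
Qed.

End strong_norm.

Lemma eq_of_geometric_bound {R : realType} (a b C xi : R) : 0 <= xi -> xi < 1 ->
  (forall n, (1 <= n)%N -> `|a - b| <= C * xi ^+ n) -> a = b.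
Proof.
move=> xi0 xi1 abC; apply/eqP; rewrite -subr_eq0 -normr_le0.
have cvgC : (fun n => C * xi ^+ n) @ \oo --> (0 : R).
  by apply: cvg_geometric; rewrite ger0_norm.
rewrite -(cvg_lim (@Rhausdorff R) cvgC); apply: limr_ge.
  exact: cvgP cvgC.
by near=> n; apply: abC; near: n; exists 1%N.
Unshelve. all: by end_near. Qed.

Section spectral_gap_theory.
Context {R : realType} {X K : pmetricType R}.
Local Notation XK := (borel X * borel K)%type.
Variables (m : probability (borel X) R) (F : XK -> XK).
Variables (P N : {charge set XK -> \bar R} -> {charge set XK -> \bar R}).
Variables (xi M D : R).
Hypotheses (mF : measurable_fun [set: XK] F) (gap : spectral_gap m F P N xi M)
  (XD : forall x y : X, mdist x y <= D).
Implicit Types (mu : {charge set XK -> \bar R}) (h : XK -> R).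

(** The functions to which [normr_charge_integral_le] applies. *)
Definition leaf_test (C : R) h : Prop :=
  [/\ bounded_measurable h, 0 < C, forall p, `|h p| <= C &
      forall x y1 y2, `|h (x, y1) - h (x, y2)| <= C * mdist (y1 : K) y2].

Lemma leaf_test1 : leaf_test 1 (fun=> 1).
Proof.
split=> //; first exact: bounded_measurable_cst.
- by move=> p; rewrite normr1.
- by move=> x y1 y2; rewrite subrr normr0 mul1r mdist_ge0.
Qed.

Lemma measurable_iter n : measurable_fun [set: XK] (iter n F).
Proof.
elim: n => [|n IHn]; first exact: measurable_id.
exact: measurableT_comp mF IHn.
Qed.

Lemma iter_gap_stable mu n : in_Sinfty m mu -> in_Sinfty m (iter n N mu).
Proof. by move=> Smu; elim: n => //= n; exact: (gap_N_stable gap). Qed.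

(** [P] and [N] annihilate each other and [P] is idempotent, so no mixed term
    appears in the powers of [P + N]. *)
Lemma transfer_iter mu n E : in_Sinfty m mu -> (1 <= n)%N -> measurable E ->
  mu (iter n F @^-1` E) = (P mu E + iter n N mu E)%E.
Proof.
move=> Smu; case: n => // n _; elim: n E => [|n IHn] E mE.
  exact: (gap_decomposition gap Smu mE).
have mFE : measurable (F @^-1` E).
  by rewrite -[X in measurable X]setTI; exact: mF.
have -> : iter n.+2 F @^-1` E = iter n.+1 F @^-1` (F @^-1` E) by [].
rewrite IHn//.
have -> : P mu (F @^-1` E) = P mu E.
  rewrite -[LHS]/(transfer F (P mu) E).
  rewrite (gap_decomposition gap (gap_P_stable gap Smu) mE) /= /cadd /=.
  by rewrite (gap_PP gap Smu mE) (gap_NP gap Smu mE) /czero adde0.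
congr (_ + _)%E; have SN := iter_gap_stable n Smu.
rewrite -[LHS]/(transfer F (N (iter n N mu)) E).
rewrite (gap_decomposition gap (gap_N_stable gap SN) mE) /= /cadd /=.
by rewrite (gap_PN gap SN mE) /czero add0e.
Qed.

Lemma charge_integral_iter mu h n : in_Sinfty m mu -> (1 <= n)%N ->
  bounded_measurable h ->
  charge_integral mu (h \o iter n F) =
  charge_integral (P mu) h + charge_integral (iter n N mu) h.
Proof.
move=> Smu n1 bh; rewrite -charge_integral_cadd//; apply/esym.
apply: charge_integral_pushforward (measurable_iter n) _ bh => E mE.
by rewrite (transfer_iter Smu n1 mE).
Qed.

Lemma charge_integral_gap mu h C n : in_Sinfty m mu -> (1 <= n)%N ->
  leaf_test C h ->
  (`|charge_integral (iter n N mu) h|%:E <=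
   C%:E * ((M * xi ^+ n)%:E * norm_Sinfty m mu))%E.
Proof.
move=> Smu n1 [bh C0 hC hLip].
have [[AB _] _] := iter_gap_stable n Smu.
apply: le_trans (normr_charge_integral_le AB bh C0 hC hLip) _.
apply: lee_wpmul2l; first exact/ltW.
by apply: le_trans (norm_infty_le_Sinfty _ _) _; exact: (gap_bound gap).
Qed.

(** The [N]-part of the iterates disappears in the limit, so a test integral
    that the dynamics does not change is already that of the [P]-part. *)
Lemma charge_integral_P mu h C : in_Sinfty m mu -> leaf_test C h ->
  (forall n, charge_integral mu (h \o iter n F) = charge_integral mu h) ->
  charge_integral (P mu) h = charge_integral mu h.
Proof.
move=> Smu tCh hF; have Soo := norm_Sinfty_lty XD Smu.
have Sfin : norm_Sinfty m mu \is a fin_num.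
  by rewrite ge0_fin_numE// norm_Sinfty_ge0.
apply/esym/(@eq_of_geometric_bound _ _ _ (C * M * fine (norm_Sinfty m mu)) xi).
- exact: ltW (gap_xi_gt0 gap).
- exact: gap_xi_lt1 gap.
move=> n n1; rewrite -(hF n).
have [bh _ _ _] := tCh.
rewrite charge_integral_iter// addrAC subrr add0r -lee_fin.
apply: le_trans (charge_integral_gap Smu n1 tCh) _.
rewrite -(fineK Sfin) -!EFinM lee_fin le_eqVlt; apply/orP; left; apply/eqP.
by rewrite -!mulrA; congr (_ * (_ * _)); rewrite mulrC.
Qed.

(** The image of [P] is a line and [P] preserves total mass, which determines
    the multiple of [P mu0]. *)
Lemma charge_integral_P_rank1 (mu0 : probability XK R) mu h C :
  in_Sinfty m (charge_of_finite_measure mu0) ->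
  (forall E, measurable E ->
    transfer F (charge_of_finite_measure mu0) E = mu0 E) ->
  in_Sinfty m mu -> leaf_test C h ->
  charge_integral (P mu) h = charge_integral mu (fun=> 1) * \int[mu0]_p h p.
Proof.
move=> Smu0 inv Smu tCh; have [bh _ _ _] := tCh.
have b1 := @bounded_measurable_cst R _ XK 1.
have invn n E : measurable E -> mu0 (iter n F @^-1` E) = mu0 E.
  elim: n E => [//|n IHn] E mE.
  have -> : iter n.+1 F @^-1` E = iter n F @^-1` (F @^-1` E) by [].
  rewrite IHn; first exact: inv.
  by rewrite -[X in measurable X]setTI; exact: mF.
have P0 g C' : leaf_test C' g ->
    charge_integral (P (charge_of_finite_measure mu0)) g = \int[mu0]_p g p.
  move=> tg; have [bg _ _ _] := tg.
  rewrite -charge_integral_measure//; apply: charge_integral_P tg _ => // n.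
  apply/esym; apply: charge_integral_pushforward (measurable_iter n) _ bg.
  by move=> E mE; apply/esym; exact: invn.
have [nu _ [_ imP]] := gap_dim_imP gap.
have [c0 P0E] := imP _ Smu0; have [c1 P1E] := imP _ Smu.
have mass0 : c0 * charge_integral (P nu) (fun=> 1) = 1.
  rewrite -charge_integral_cscale// -(eq_charge_integral P0E b1).
  rewrite (P0 _ _ leaf_test1) Rintegral_cst// mul1r.
  by rewrite [X in fine X]probability_setT.
have mass1 :
    c1 * charge_integral (P nu) (fun=> 1) = charge_integral mu (fun=> 1).
  rewrite -charge_integral_cscale// -(eq_charge_integral P1E b1).
  exact: (charge_integral_P Smu leaf_test1).
rewrite (eq_charge_integral P1E bh) -(P0 _ _ tCh) (eq_charge_integral P0E bh).
rewrite !charge_integral_cscale// -mass1.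
by rewrite -[LHS]mul1r -[X in X * _ = _]mass0 mulrACA [c0 * c1]mulrC mulrACA.
Qed.

End spectral_gap_theory.

(** * Decay of correlations *)

Theorem theorem4 (R : realType) (N0 : nat) (A : aperiodic_matrix N0)
    (theta : {itv R & `]0%Z, 1%Z[})
    (m : probability (borel (shift_space A theta)) R)
    (m_markov : is_markov_measure m)
    (K : pmetricType R) (K_compact : compact [set: K])
    (K_diam : diam K = 1%:E)
    (G : borel (shift_space A theta) * borel K -> borel K)
    (G_meas : measurable_fun setT G)
    (G_contraction : exists alpha : R, [/\ 0 < alpha, alpha < 1 &
      {ae m, forall x, forall y1 y2 : K,
        mdist (G (x, y1) : K) (G (x, y2) : K) <= alpha * mdist y1 y2}])
    (G_lipschitz : exists k : K -> R, [/\ forall y, 0 <= k y,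
      forall (y : K) (x1 x2 : shift_space A theta),
        mdist (G (x1, y) : K) (G (x2, y) : K) <= k y * d_theta x1 x2 &
      has_ubound (range k)])
    (mu0 : probability (borel (shift_space A theta) * borel K)%type R)
    (mu0_Sinfty : in_Sinfty m (charge_of_finite_measure mu0))
    (mu0_invariant : forall E, measurable E ->
      transfer (skew_product G) (charge_of_finite_measure mu0) E = mu0 E)
    (P N : {charge set (borel (shift_space A theta) * borel K)%type -> \bar R} ->
           {charge set (borel (shift_space A theta) * borel K)%type -> \bar R})
    (xi M : R)
    (gap : spectral_gap m (skew_product G) P N xi M) :
  forall h f : borel (shift_space A theta) * borel K -> R,
    is_lipschitz sum_dist h -> is_lipschitz sum_dist f ->
  forall n : nat, (1 <= n)%N ->
    ((`| \int[mu0]_p (h (iter n (skew_product G) p) * f p)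
         - (\int[mu0]_p h p) * (\int[mu0]_p f p) |)%:E
     <= (M * xi ^+ n)%:E * norm_Sinfty m (density_charge mu0 f)
        * lip_norm sum_dist h)%E.
Proof.
move=> h f hL fL n n1.
have bh := bounded_measurable_lipschitz K_diam hL.
have bf := bounded_measurable_lipschitz K_diam fL.
have mF := measurable_skew_product G_meas.
have [_ [C hC]] := bh.
set mu := density_charge mu0 f.
set F := skew_product G in gap mF *.
have itF :
    \int[mu0]_p (h (iter n F p) * f p) = charge_integral mu (h \o iter n F).
  rewrite charge_integral_density//.
  exact: bounded_measurable_comp (measurable_iter mF n) bh.
have massf : charge_integral mu (fun=> 1) = \int[mu0]_p f p.
  rewrite charge_integral_density//; last exact: bounded_measurable_cst.
  by apply: eq_Rintegral => p _; rewrite mul1r.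
have hfin := lip_norm_fin_num hL hC.
have MxiS0 : (0 < (M * xi ^+ n)%:E)%E.
  by rewrite lte_fin mulr_gt0 ?(gap_M_gt0 gap)// exprn_gt0// (gap_xi_gt0 gap).
(* If h = 0, the right-hand side may be the product of +oo and 0, which is 0. *)
have [L0|L0] := eqVneq (fine (lip_norm sum_dist h)) 0.
  have h0 p : h p = 0.
    by apply/eqP; rewrite -normr_le0 -L0; exact: (normr_le_lip_norm p hL hC).
  rewrite -(fineK hfin) L0 mule0 lee_fin.
  under eq_Rintegral do rewrite h0 mul0r.
  under [X in _ - X * _]eq_Rintegral do rewrite h0.
  by rewrite Rintegral_cst// !mul0r subrr normr0.
have Lpos : 0 < fine (lip_norm sum_dist h).
  by rewrite lt_neqAle eq_sym L0 fine_ge0// lip_norm_ge0.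
have [Soo|Sfin] := eqVneq (norm_Sinfty m mu) +oo%E.
  by rewrite Soo gt0_muley// gt0_mulye ?leey// -(fineK hfin) lte_fin.
have Smu : in_Sinfty m mu.
  apply: in_Sinfty_norm_lty; last by rewrite ltey.
  by apply: in_AB_density => //; case: mu0_Sinfty => -[].
have test : leaf_test (fine (lip_norm sum_dist h)) h.
  split=> // [p|x y1 y2]; first exact: (normr_le_lip_norm p hL hC).
  apply: le_trans (normrB_le_lip_norm (@sum_dist_ge0 _ _ _ _ _) _ _ hL hC) _.
  by rewrite /sum_dist/= mdistxx add0r.
have XD (x y : shift_space A theta) : mdist x y <= (1 - theta%:num)^-1.
  exact: d_theta_le.
rewrite itF (charge_integral_iter mF gap Smu n1 bh).
rewrite (charge_integral_P_rank1 mF gap XD mu0_Sinfty mu0_invariant Smu test).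
rewrite massf mulrC addrAC subrr add0r muleC -[X in (X * _)%E](fineK hfin).
exact: (charge_integral_gap gap Smu n1 test).
Qed.
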